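(* Let $0\le k\le n$ and let $\mathsf{N}_1,\dots,\mathsf{N}_s$ be a set of representatives of the isomorphism classes of cuspidal matroids of rank $k$ on $n$ elements. Then for every matroid $\mathsf{M}$ of rank $k$ on $n$ elements there exist unique integers $c_1,\dots,c_s$ such that $T_{\mathsf{M}}(x,y)=\sum_{i=1}^s c_i\,T_{\mathsf{N}_i}(x,y)$.
   Context: $T_{\mathsf{M}}(x,y)$ is the Tutte polynomial. $\mathsf{U}_{r,m}$ is the uniform matroid of rank $r$ on $m$ elements. A matroid is elementary split if it has no minor isomorphic to $\mathsf{U}_{0,1}\oplus\mathsf{U}_{1,2}\oplus\mathsf{U}_{1,1}$; it is Schubert (nested) if its lattice of cyclic flats is a chain; it is cuspidal if it is both Schubert and elementary split. *)

(* Defs.v *)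
From HB Require Import structures.
From mathcomp Require Import all_boot all_order all_algebra all_fingroup.
Set Implicit Arguments. Unset Strict Implicit. Unset Printing Implicit Defensive.
Import GRing.Theory.

Definition basis_exchange (T : finType) (B : {set {set T}}) : Prop :=
  forall B1 B2, B1 \in B -> B2 \in B ->
  forall x, x \in B1 :\: B2 ->
  exists2 y, y \in B2 :\: B1 & (B1 :\ x) :|: [set y] \in B.

Record matroid (T : finType) := Matroid {
  bases : {set {set T}};
  bases_nonempty : bases != set0;
  bases_exchange : basis_exchange bases }.

Definition mrank (T : finType) (M : matroid T) (A : {set T}) : nat :=
  \max_(B in bases M) #|A :&: B|.

Definition mrk (T : finType) (M : matroid T) : nat := mrank M setT.

(* Tutte polynomial in Z[x,y] = {poly {poly int}}: x is the outer variable 'X,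
   y is the inner variable ('X)%:P. *)
Definition tutte (T : finType) (M : matroid T) : {poly {poly int}} :=
  \sum_(A : {set T})
     (('X - 1) ^+ (mrk M - mrank M A) * (('X - 1)%:P) ^+ (#|A| - mrank M A))%R.

Definition miso (T : finType) (M N : matroid T) : Prop :=
  exists s : {perm T}, bases N = [set (s @: B) | B : {set T} in bases M].

Definition is_flat (T : finType) (M : matroid T) (F : {set T}) : Prop :=
  forall x, x \notin F -> mrank M F < mrank M (x |: F).
Definition is_cyclic (T : finType) (M : matroid T) (F : {set T}) : Prop :=
  forall x, x \in F -> mrank M (F :\ x) = mrank M F.
Definition cyclic_flat (T : finType) (M : matroid T) (F : {set T}) : Prop :=
  is_flat M F /\ is_cyclic M F.

Definition schubert (T : finType) (M : matroid T) : Prop :=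
  forall F G, cyclic_flat M F -> cyclic_flat M G -> F \subset G \/ G \subset F.

(* M has a minor isomorphic to the matroid on T' with rank function rN:
   there are a contraction set C and an injection f : T' -> T with image disjoint
   from C such that the minor (M / C) restricted to f(T') (i.e. deleting the rest)
   has rank function rN transported along f. *)
Definition has_minor_iso (T T' : finType) (M : matroid T) (rN : {set T'} -> nat) : Prop :=
  exists (C : {set T}) (f : T' -> T),
    [/\ injective f, [disjoint C & f @: [set: T']] &
        forall X : {set T'}, mrank M (f @: X :|: C) - mrank M C = rN X].

Definition urank (r : nat) (m : nat) (X : {set 'I_m}) : nat := minn #|X| r.

Arguments urank r m X : clear implicits.
Definition dsum_rank (T1 T2 : finType) (r1 : {set T1} -> nat) (r2 : {set T2} -> nat)
  (X : {set T1 + T2}) : nat :=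
  r1 [set x | inl x \in X] + r2 [set x | inr x \in X].

Definition forbidden_rank : {set ('I_1 + 'I_2) + 'I_1} -> nat :=
  dsum_rank (dsum_rank (urank 0 1) (urank 1 2)) (urank 1 1).

Definition elementary_split (T : finType) (M : matroid T) : Prop :=
  ~ has_minor_iso M forbidden_rank.

Definition cuspidal (T : finType) (M : matroid T) : Prop :=
  schubert M /\ elementary_split M.

(* Main.v *)
Require Import Defs.
From HB Require Import structures.
From mathcomp Require Import all_boot all_order all_algebra all_fingroup.
From mathcomp Require Import zify ring.
Import GRing.Theory.
Set Implicit Arguments. Unset Strict Implicit. Unset Printing Implicit Defensive.

(* Every rank equals rk F + |A \ F| for some cyclic flat F.  If F < G are cyclic
   flats of an elementary split matroid then F is empty or G is everything, so a
   cuspidal matroid has at most one cyclic flat H other than those two, and its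
   rank function is min(|A|, k, rk H + |A \ H|), determined up to isomorphism by
   the corank p and the nullity q of H.  Modulo the Tutte polynomial of the
   uniform matroid, T_M is the sum over A of terms depending only on the corank
   and the nullity of A, which vanish unless both are positive.  In the cuspidal
   matroid (p, q) these are at most p and q, with joint equality only for A = H.
   So the transition matrix is unitriangular over the integers. *)

(** * Rank functions derived from basis exchange *)

Section MatroidRank.
Variables (T : finType) (M : matroid T).
Implicit Types (A B C F G H : {set T}) (x y : T).
Local Notation rk := (mrank M).

(** Kept additive so that an exchange can be tracked by [lia] without truncated subtraction;
    [A = setT] gives the plain cardinality. *)
Lemma card_swapI A B x y : x \in B -> y \notin B ->
  #|(B :\ x :|: [set y]) :&: A| + (x \in A) = #|B :&: A| + (y \in A).
Proof.
move=> xB yB.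
rewrite (cardsD1 x (B :&: A)) (cardsD1 y (_ :&: A)) !inE xB eqxx orbT /=.
suff -> : ((B :\ x :|: [set y]) :&: A) :\ y = (B :&: A) :\ x by lia.
apply/setP => z; rewrite !inE.
case: (eqVneq z y) => [->|_]; last by rewrite /= orbF andbA.
by rewrite (negPf yB) /= andbF.
Qed.

Lemma card_swap B x y : x \in B -> y \notin B -> #|B :\ x :|: [set y]| = #|B|.
Proof.
by move=> xB yB; have := card_swapI setT xB yB; rewrite !setIT !inE; lia.
Qed.

(** If [B1] were larger, take a basis of its size meeting [B2] as much as possible. It still has an
    element outside [B2], and exchanging that element increases the intersection. *)
Lemma bases_card_leq B1 B2 : B1 \in bases M -> B2 \in bases M -> #|B1| <= #|B2|.
Proof.
move=> B1M B2M; rewrite leqNgt; apply/negP => lt21.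
pose P B := (B \in bases M) && (#|B| == #|B1|).
have P1 : P B1 by rewrite /P B1M eqxx.
case: (arg_maxnP (fun B => #|B :&: B2|) P1) => B /andP[BM /eqP cB] maxB.
have /subsetPn[x xB xB2] : ~~ (B \subset B2).
  by apply/negP => /subset_leq_card; rewrite cB leqNgt lt21.
have xD : x \in B :\: B2 by rewrite inE xB2.
have [y] := bases_exchange BM B2M xD; rewrite inE => /andP[yB yB2] BM'.
have /maxB : P ((B :\ x) :|: [set y]) by rewrite /P BM' card_swap // cB eqxx.
have := card_swapI B2 xB yB; rewrite (negPf xB2) yB2 /=; clear; lia.
Qed.

Lemma bases_card B1 B2 : B1 \in bases M -> B2 \in bases M -> #|B1| = #|B2|.
Proof. by move=> ? ?; apply/eqP; rewrite eqn_leq !bases_card_leq. Qed.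

Lemma mrank_basis A : exists2 B, B \in bases M & rk A = #|A :&: B|.
Proof.
have [B0 B0M] := set0Pn _ (bases_nonempty M).
have c0 : 0 < #|bases M| by apply/card_gt0P; exists B0.
by have [B BM e] := eq_bigmax_cond (fun B => #|A :&: B|) c0; exists B.
Qed.

Lemma leq_mrank A B : B \in bases M -> #|A :&: B| <= rk A.
Proof. exact: (@leq_bigmax_cond _ (mem (bases M)) (fun B => #|A :&: B|)). Qed.

Lemma mrk_bases B : B \in bases M -> mrk M = #|B|.
Proof.
move=> BM; have [B' B'M] := mrank_basis setT.
by rewrite /mrk setTI => ->; apply: bases_card.
Qed.

(** Recovers the bases from the rank function, so that a rank-preserving permutation is an
    isomorphism. *)
Lemma mem_basesP B : reflect (mrank M B = #|B| /\ #|B| = mrk M) (B \in bases M).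
Proof.
apply: (iffP idP) => [BM|[rB cB]].
  split; last by rewrite (mrk_bases BM).
  apply/eqP; rewrite eqn_leq -{3}[B]setIid leq_mrank // andbT.
  by have [B' _ ->] := mrank_basis B; rewrite subset_leq_card // subsetIl.
have [B' B'M] := mrank_basis B; rewrite rB => cBB'.
suff -> : B = B' by [].
apply/eqP; rewrite eqEcard -(mrk_bases B'M) cB leqnn andbT.
by apply/setIidPl/eqP; rewrite eqEcard subsetIl -cBB' /=.
Qed.

Lemma mrankS A B : A \subset B -> rk A <= rk B.
Proof.
move=> sAB; have [C CM ->] := mrank_basis A.
by apply: leq_trans (leq_mrank B CM); rewrite subset_leq_card // setSI.
Qed.

Lemma mrank_leq_mrk A : rk A <= mrk M.
Proof. exact/mrankS/subsetT. Qed.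

Lemma mrank_leq_card A : rk A <= #|A|.
Proof. by have [C _ ->] := mrank_basis A; rewrite subset_leq_card // subsetIl. Qed.

Lemma mrank_leqD A F : rk A <= rk F + #|A :\: F|.
Proof.
have [C CM ->] := mrank_basis A.
have /subset_leq_card : A :&: C \subset (F :&: C) :|: (A :\: F).
  by apply/subsetP => x; rewrite !inE => /andP[-> ->]; case: (x \in F).
by rewrite cardsU; have := leq_mrank F CM; lia.
Qed.

Lemma mrankU1 A x : rk (x |: A) <= (rk A).+1.
Proof.
apply: leq_trans (mrank_leqD _ A) _; rewrite -addn1 leq_add2l -(cards1 x).
by rewrite subset_leq_card // subDset setUC subxx.
Qed.

Lemma mrankD1 A x : rk A <= (rk (A :\ x)).+1.
Proof.
apply: leq_trans (mrank_leqD A (A :\ x)) _; rewrite -addn1 leq_add2l -(cards1 x).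
rewrite subset_leq_card //; apply/subsetP => y; rewrite !inE.
by case: (y == x); case: (y \in A).
Qed.

(** Let [B0] attain [rk A]. Among the bases containing [A :&: B], maximise the overlaps with [A] and
    [B0]. If the overlap with [A] were too small, some element would lie outside both [A] and [B0],
    and exchanging it for one of [B0] would raise the score. *)
Lemma basis_extend A B : B \in bases M ->
  exists B', [/\ B' \in bases M, A :&: B \subset B' & #|A :&: B'| = rk A].
Proof.
move=> BM; have [B0 B0M rA] := mrank_basis A.
pose P C := (C \in bases M) && (A :&: B \subset C).
have PB : P B by rewrite /P BM subsetIr.
case: (arg_maxnP (fun C => #|C :&: A| + #|C :&: B0|) PB) => C /andP[CM sC] maxC.
exists C; split=> //; apply/eqP; rewrite eqn_leq leq_mrank //= leqNgt rA.
apply/negP => ltC.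
have /subsetPn[x] : ~~ (C :\: A \subset B0 :\: A).
  apply/negP => /subset_leq_card.
  have := cardsID A C; have := cardsID A B0; have := bases_card CM B0M.
  by rewrite ![_ :&: A]setIC; lia.
rewrite !inE => /andP[xA xC]; rewrite xA /= => xB0.
have xD : x \in C :\: B0 by rewrite inE xB0.
have [y] := bases_exchange CM B0M xD; rewrite inE => /andP[yC yB0] CM'.
have /maxC : P ((C :\ x) :|: [set y]).
  rewrite /P CM' /=; apply/subsetP => z zAB; rewrite !inE (subsetP sC) // andbT.
  by case: eqVneq => // zx; move: zAB; rewrite zx inE (negPf xA).
have := card_swapI A xC yC; have := card_swapI B0 xC yC.
by rewrite (negPf xA) (negPf xB0) yB0; clear; case: (y \in A); lia.
Qed.

(** Closure is monotone. If [x] raised the rank of [B], a basis attaining [rk A], extended over [B]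
    and then over [x |: B], would contain [x], which forces [x |: A] to have rank above [rk A]. *)
Lemma mrank_absorb A B x : A \subset B -> rk (x |: A) = rk A -> rk (x |: B) = rk B.
Proof.
move=> sAB rxA; apply/eqP; rewrite eqn_leq (mrankS (subsetUr _ _)) andbT leqNgt.
apply/negP => ltB.
have [B1 B1M rA] := mrank_basis A.
have [B2 [B2M sB2 rB]] := basis_extend B B1M.
have [B3 [B3M sB3 rxB]] := basis_extend (x |: B) B2M.
have sB23 : B :&: B2 \subset B :&: B3.
  rewrite subsetI subsetIl /=; apply: subset_trans sB3.
  by rewrite setSI // subsetUr.
have xB3 : x \in B3.
  have := leq_mrank B B3M; apply: contraLR => xB3.
  rewrite -ltnNge; apply: leq_trans ltB _; rewrite -rxB subset_leq_card //.
  apply/subsetP => z; rewrite !inE => /andP[/orP[/eqP->|->]] //.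
  by rewrite (negPf xB3).
have xA : x \notin A.
  by apply: contraL ltB => xA; rewrite (setUidPr _) ?ltnn // sub1set (subsetP sAB).
have : #|x |: (A :&: B1)| <= rk (x |: A).
  apply: leq_trans (leq_mrank _ B3M); rewrite subset_leq_card //.
  rewrite subsetI setUS ?subsetIl //= subUset sub1set xB3 /=.
  apply: subset_trans (subset_trans sB23 (subsetIr _ _)).
  rewrite subsetI (subset_trans (subsetIl _ _) sAB) /=.
  by apply: subset_trans sB2; rewrite setSI.
by rewrite cardsU1 !inE (negPf xA) /= rxA rA; clear; lia.
Qed.

Lemma cyclic_flat_mrank A :
  exists2 F, cyclic_flat M F & rk A = rk F + #|A :\: F|.
Proof.
pose P F := rk F + #|A :\: F| <= rk A.
have PA : P A by rewrite /P setDv cards0 addn0.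
(* The weight 2 makes both repairs increase the score: adding an element of the closure gains 1, and
   deleting a coloop of [F] loses 1 in size but gains 2 in corank. *)
case: (arg_maxnP (fun F => #|F| + 2 * (mrk M - rk F)) PA) => F PF maxF.
exists F; last by apply/eqP; rewrite eqn_leq mrank_leqD.
have := mrank_leq_mrk F; rewrite /P in PF.
split=> [x xF|x xF].
  rewrite ltnNge; apply/negP => rxF.
  have /maxF : P (x |: F).
    rewrite /P; apply: leq_trans PF; apply: leq_add => //.
    by rewrite subset_leq_card // setDS // subsetUr.
  by rewrite cardsU1 xF; have := mrankS (subsetUr [set x] F); lia.
apply/eqP; rewrite eqn_leq mrankS ?subD1set //= leqNgt; apply/negP => rxF.
have /maxF : P (F :\ x).
  rewrite /P; apply: leq_trans PF.
  have /subset_leq_card : A :\: (F :\ x) \subset x |: (A :\: F).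
    by apply/subsetP => y; rewrite !inE; case: (y == x).
  by rewrite cardsU1; lia.
by rewrite (cardsD1 x F) xF; have := mrankD1 F x; lia.
Qed.

End MatroidRank.

Local Ltac set_bool :=
  apply/setP => ?; rewrite !inE;
  repeat match goal with
  | |- context [?x \in ?A] => case: (x \in A)
  | |- context [?x == ?y] => case: (x == y)
  end; rewrite ?orbT ?orbF.

(** * The forbidden minor and nested pairs of cyclic flats *)

Section Forbidden.
Local Notation E := (('I_1 + 'I_2) + 'I_1)%type.
(** The loop [e], the parallel pair [f1], [f2] and the coloop [g] of the forbidden matroid. *)
Let e : E := inl (inl ord0).
Let f1 : E := inl (inr ord0).
Let f2 : E := inl (inr (lift ord0 ord0)).
Let g : E := inr ord0.

Lemma forbidden_rankE (X : {set E}) :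
  forbidden_rank X = ((f1 \in X) || (f2 \in X)) + (g \in X).
Proof.
rewrite /forbidden_rank /dsum_rank /urank minn0 add0n.
congr (_ + _); rewrite -sum1_card big_mkcond /= !big_ord_recl big_ord0 !inE -/f1 -/f2 -/g.
  by case: (f1 \in X); case: (f2 \in X).
by case: (g \in X).
Qed.

Lemma forbidden_ind (P : E -> Prop) : P e -> P f1 -> P f2 -> P g -> forall z, P z.
Proof.
move=> Pe P1 P2 Pg [[z|[[|[|m]] lt]]|z].
- by rewrite (ord1 z).
- by rewrite (_ : Ordinal lt = ord0) //; apply: val_inj.
- by rewrite (_ : Ordinal lt = lift ord0 ord0) //; apply: val_inj.
- by [].
- by rewrite (ord1 z).
Qed.

Variables (T : finType) (M : matroid T).
Implicit Types A B C F G H : {set T}.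
Local Notation rk := (mrank M).

(** The booleans run through the 16 subsets of the four elements; [a] is missing on the right
    because [ze] must become a loop. *)
Lemma forbidden_minor C (ze z1 z2 zg : T) :
  uniq [:: ze; z1; z2; zg] -> ze \notin C -> z1 \notin C -> z2 \notin C -> zg \notin C ->
  (forall a b c d : bool,
    rk ((if a then [set ze] else set0) :|: (if b then [set z1] else set0)
       :|: (if c then [set z2] else set0) :|: (if d then [set zg] else set0) :|: C)
      = rk C + ((b || c) + d)) ->
  has_minor_iso M forbidden_rank.
Proof.
move=> /= /and4P[] ; rewrite !inE !negb_or => /and3P[e1 e2 eg] /andP[n12 n1g] n2g _.
move=> neC n1C n2C ngC rkC.
pose f (z : E) := match z with
  | inl (inl _) => ze
  | inl (inr i) => if i == ord0 then z1 else z2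
  | inr _ => zg end.
exists C, f; split.
- move=> z1' z2'; elim/forbidden_ind: z1'; elim/forbidden_ind: z2' => //=;
    move/eqP; rewrite /f /=;
    do ?[rewrite ?(negPf e1, negPf e2, negPf eg, negPf n12, negPf n1g, negPf n2g) //;
         rewrite eq_sym].
- rewrite disjoint_sym disjoint_subset; apply/subsetP => _ /imsetP[z _ ->].
  by rewrite inE; elim/forbidden_ind: z.
move=> X; rewrite forbidden_rankE.
have := rkC (e \in X) (f1 \in X) (f2 \in X) (g \in X).
set Y := (X in rk (X :|: C)); suff -> : f @: X = Y by move=> ->; rewrite addKn.
apply/setP => t; rewrite /Y !inE.
have mem_if (b : bool) (w : T) : (t \in (if b then [set w] else set0)) = b && (t == w).
  by case: b; rewrite !inE.
rewrite !mem_if.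
apply/imsetP/idP => [[z zX ->]|].
  by elim/forbidden_ind: z zX => zX; rewrite zX eqxx ?orbT.
by case/orP => [/orP[/orP[]|]|] /andP[zX /eqP->]; [exists e|exists f1|exists f2|exists g].
Qed.

(** Otherwise pick [ze] in [F] and [zg] outside [G], let [D] be a hyperplane of the restriction to
    [G] containing [F], and contract [D :\ ze]. Then [ze] is a loop as [F] is cyclic, [zg] is a
    coloop as [G] is flat, and two elements of [G] outside [D] are parallel. *)
Lemma elementary_split_cyclic_flats F G : elementary_split M ->
  cyclic_flat M F -> cyclic_flat M G -> F \subset G -> F != G ->
  F = set0 \/ G = setT.
Proof.
move=> esM [flF cyF] [flG cyG] sFG neFG.
case: (set_0Vmem F) => [|[ze eF]]; first by left.
case: (eqVneq G setT) => [|GT]; first by right.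
have /subsetPn[zg _ gG] : ~~ (setT \subset G) by rewrite subTset.
case: esM.
have /subsetPn[x xG xF] : ~~ (G \subset F).
  by apply: contra neFG => sGF; rewrite eqEsubset sFG.
pose P C := [&& F \subset C, C \subset G & rk C < rk G].
have PF : P F.
  rewrite /P subxx sFG /=; apply: leq_trans (flF x xF) (mrankS _ _).
  by rewrite subUset sub1set xG.
case: (arg_maxnP (fun C => #|C|) PF) => D /and3P[sFD sDG ltD] maxD.
have addD z : z \in G -> z \notin D -> rk (z |: D) = rk G.
  move=> zG zD; apply/eqP; rewrite eqn_leq mrankS ?subUset ?sub1set ?zG //=.
  rewrite leqNgt; apply/negP => lt.
  have /maxD : P (z |: D).
    by rewrite /P lt subUset sub1set zG sDG (subset_trans sFD) ?subsetUr.
  by rewrite cardsU1 zD /=; clear; lia.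
have /subsetPn[z1 z1G z1D] : ~~ (G \subset D).
  by apply: contraL ltD => /(mrankS M); rewrite -leqNgt.
have rG : rk G = (rk D).+1.
  by apply/eqP; rewrite eqn_leq ltD -(addD z1) ?mrankU1.
(* Cyclicity of [G] supplies the second parallel element: [G :\ z1] keeps the full rank of [G], so
   it does not fit inside [D]. *)
have /subsetPn[z2] : ~~ (G :\ z1 \subset D).
  by apply: contraL ltD => /(mrankS M); rewrite (cyG z1 z1G) -leqNgt.
rewrite !inE => /andP[n21 z2G] z2D.
have eD : ze \in D by apply: (subsetP sFD).
have gD : zg \notin D by apply: contra gG; apply: (subsetP sDG).
have absE A : F :\ ze \subset A -> rk (ze |: A) = rk A.
  by move=> sA; apply: (mrank_absorb sA); rewrite setD1K // cyF.
have addg A : A \subset G -> rk (zg |: A) = (rk A).+1.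
  move=> sA; apply/eqP; rewrite eqn_leq mrankU1 /= ltnNge.
  apply/negP => le; have := flG zg gG; rewrite (mrank_absorb sA) ?ltnn //.
  by apply/eqP; rewrite eqn_leq le mrankS ?subsetUr.
have n_in z A : z \in A -> forall w, w \notin A -> z != w.
  by move=> zA w; apply: contra => /eqP<-.
apply: (@forbidden_minor (D :\ ze) ze z1 z2 zg).
- rewrite /= !inE !negb_or !(n_in _ _ eD) // (eq_sym z1) n21.
  by rewrite !(n_in _ G).
- by rewrite !inE eqxx.
- by rewrite !inE (negPf z1D) andbF.
- by rewrite !inE (negPf z2D) andbF.
- by rewrite !inE (negPf gD) andbF.
have sC : F :\ ze \subset D :\ ze by rewrite setSD.
have rC : rk (D :\ ze) = rk D by rewrite -[in RHS](setD1K eD) absE.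
move=> a b c d; rewrite rC.
set Z1 := if b then _ else _; set Z2 := if c then _ else _.
have sZ : Z1 :|: Z2 \subset G.
  by rewrite subUset /Z1 /Z2; case: (b); case: (c); rewrite ?sub0set ?sub1set ?z1G ?z2G.
(* Putting [ze] back changes no rank, so the computation can be done over [D] instead of
   [D :\ ze]. *)
transitivity (rk ((if d then [set zg] else set0) :|: (Z1 :|: Z2 :|: D))).
  rewrite -[in RHS](setD1K eD).
  set S := (if d then _ else _).
  have -> : S :|: (Z1 :|: Z2 :|: (ze |: D :\ ze)) = ze |: (S :|: (Z1 :|: Z2 :|: (D :\ ze))).
    by set_bool.
  rewrite absE; last by rewrite !setUA (subset_trans sC) // subsetUr.
  case: a; last by congr (rk _); set_bool.
  rewrite -[RHS]absE; last by rewrite !setUA (subset_trans sC) // subsetUr.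
  by congr (rk _); set_bool.
have rbc : rk (Z1 :|: Z2 :|: D) = rk D + (b || c).
  have: Z1 :|: Z2 :|: D \subset G by rewrite subUset sZ.
  move=> /(mrankS M); rewrite /Z1 /Z2.
  case: (b); case: (c) => /=; rewrite ?set0U ?setU0 ?addn0 ?addn1 ?addD //.
  move=> le; apply/eqP; rewrite eqn_leq -rG le /= -(addD z1) // mrankS //.
  by rewrite setSU // subsetUl.
rewrite addnA -rbc; case: d; last by rewrite set0U addn0.
by rewrite addg ?addn1 // subUset sZ.
Qed.

End Forbidden.

(** * Cuspidal matroids classified by the corank and nullity of one set *)

Section Shape.
Variable T : finType.
Implicit Types (M N : matroid T) (A B C F G H : {set T}) (x y : T).

Lemma subset_of_card A m : m <= #|A| -> exists2 B : {set T}, B \subset A & #|B| = m.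
Proof.
move=> lem.
have: 0 < #|[set B : {set T} | (B \subset A) && (#|B| == m)]|.
  by rewrite cards_draws bin_gt0.
by case/card_gt0P => B; rewrite inE => /andP[sBA /eqP cB]; exists B.
Qed.

(** List each set followed by its complement; the permutation matches equal positions in the two
    lists. *)
Lemma perm_imset_card A B : #|A| = #|B| -> exists s : {perm T}, s @: A = B.
Proof.
move=> cAB.
pose e C := enum C ++ enum (~: C).
have eU C : uniq (e C).
  rewrite cat_uniq !enum_uniq andbT /=; apply/hasPn => x.
  by rewrite !mem_enum inE.
have eT C x : x \in e C by rewrite mem_cat !mem_enum inE orbN.
have eS C : size (e C) = #|T| by rewrite size_cat -!cardE cardsC.
pose f x := nth x (e B) (index x (e A)).
have fi : injective f.
  move=> x y; have ix z : index z (e A) < size (e B).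
    by rewrite eS -(eS A) index_mem.
  rewrite /f (set_nth_default y) // => /eqP.
  by rewrite nth_uniq // => /eqP ixy; rewrite -(nth_index x (eT A x)) ixy nth_index.
exists (perm fi); apply/eqP; rewrite eqEcard card_imset; last exact: perm_inj.
rewrite cAB leqnn andbT; apply/subsetP => _ /imsetP[x xA ->].
have ixA : index x (enum A) < #|B| by rewrite -cAB cardE index_mem mem_enum.
rewrite permE /f /e index_cat mem_enum xA nth_cat -cardE ixA -mem_enum mem_nth //.
by rewrite -cardE.
Qed.

Lemma cardU1D A H x : x \notin A -> #|(x |: A) :\: H| = (x \notin H) + #|A :\: H|.
Proof.
move=> xA; rewrite setDUl; case: (boolP (x \in H)) => xH.
  by rewrite (_ : [set x] :\: H = set0) ?set0U //; apply/eqP; rewrite setD_eq0 sub1set.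
by rewrite (setDidPl _) ?disjoints1 // cardsU1 inE (negPf xA) andbF.
Qed.

(* The cuspidal matroid of rank [k = mrk M] whose bases are the [k]-sets meeting
   [H] in at most [k - p] elements; [p] and [q] are the corank and the nullity
   of [H].  Uniform matroids are those with [p = 0] or [q = 0]. *)
Definition cusp_shape M (p q : nat) H : Prop :=
  [/\ p <= mrk M, #|H| = mrk M - p + q &
      forall A, mrank M A = minn #|A| (minn (mrk M) (mrk M - p + #|A :\: H|))].

(** A boolean form, so that [pickP] can search for a cyclic flat. *)
Definition cyclic_flatb M F : bool :=
  [forall x, if x \in F then mrank M (F :\ x) == mrank M F
             else mrank M F < mrank M (x |: F)].

Lemma cyclic_flatP M F : reflect (cyclic_flat M F) (cyclic_flatb M F).
Proof.
apply: (iffP forallP) => [cF|[fl cy] x].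
  by split=> x xF; have := cF x; rewrite ?xF ?(negPf xF) // => /eqP.
by case: (boolP (x \in F)) => xF; [rewrite cy | apply: fl].
Qed.

(** The condition on positivity normalises uniform matroids to [p = q = 0], so that non-isomorphic
    cuspidal matroids get different pairs. *)
Lemma cuspidal_shape M : cuspidal M ->
  exists p q H, cusp_shape M p q H /\ (0 < p) = (0 < q).
Proof.
move=> [schM esM].
have [H cfH] : exists H, forall F, cyclic_flat M F -> [\/ F = set0, F = H | F = setT].
  case: (pickP (fun F => [&& cyclic_flatb M F, F != set0 & F != setT])).
    move=> H /and3P[/cyclic_flatP cH H0 HT]; exists H => F cF.
    case: (eqVneq F H) => [|neFH]; first by constructor 2.
    case: (schM _ _ cF cH) => sub.
      have [->|eH] := elementary_split_cyclic_flats esM cF cH sub neFH.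
        by constructor 1.
      by rewrite eH eqxx in HT.
    rewrite eq_sym in neFH.
    have [eH|->] := elementary_split_cyclic_flats esM cH cF sub neFH.
      by rewrite eH eqxx in H0.
    by constructor 3.
  move=> none; exists set0 => F /cyclic_flatP cF; have := none F; rewrite cF /=.
  case: eqVneq => [->|_]; first by constructor 1.
  by case: eqVneq => // ->; constructor 3.
(* The three terms are the values for the cyclic flat candidates [set0], [setT] and [H]; each bounds
   the rank, and [cyclic_flat_mrank] says that one is attained. *)
have rk A : mrank M A = minn #|A| (minn (mrk M) (mrank M H + #|A :\: H|)).
  have := mrank_leqD M A H; have := mrank_leq_card M A; have := mrank_leq_mrk M A.
  have [F /cfH cF] := cyclic_flat_mrank M A.
  have r0 : mrank M set0 = 0 by have := mrank_leq_card M set0; rewrite cards0; lia.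
  by case: cF => ->; rewrite ?r0 ?setD0 ?setDT ?cards0 -/(mrk M); clear; lia.
have := mrank_leq_mrk M H; have := mrank_leq_card M H => leH lek.
case: (boolP ((mrank M H < mrk M) && (mrank M H < #|H|))) => [/andP[p0 q0]|triv].
  exists (mrk M - mrank M H), (#|H| - mrank M H), H.
  rewrite !subn_gt0 p0 q0; split=> //; split; rewrite ?leq_subr ?subKn //; lia.
(* Here [H] has full rank or is independent, so the matroid is uniform; any basis has the size
   required of [H] when [p = q = 0]. *)
have [B BM] := set0Pn _ (bases_nonempty M).
exists 0, 0, B; split=> //; split=> //; first by rewrite subn0 addn0 (mrk_bases BM).
move=> A; rewrite rk subn0.
have : #|A| <= #|H| + #|A :\: H|.
  by rewrite -(cardsID H A) leq_add2r subset_leq_card // subsetIr.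
by move: leH lek triv; clear; lia.
Qed.

(** The term attaining the minimum at [F] identifies [F]: an independent cyclic set is empty, a flat
    of full rank is everything, and in the third case an element in just one of [F], [H] breaks
    cyclicity or flatness. *)
Lemma shape_cyclic_flat M p q H F : cusp_shape M p q H -> cyclic_flat M F ->
  [\/ F = set0, F = H | F = setT].
Proof.
move=> [_ _ rk] [flF cyF].
have : [|| mrank M F == #|F|, mrank M F == mrk M | mrank M F == mrk M - p + #|F :\: H|].
  by rewrite rk; clear; lia.
case/or3P => /eqP rF.
- constructor 1; apply/setP => x; rewrite inE; apply/negP => xF.
  have := cyF x xF; have := mrank_leq_card M (F :\ x).
  by rewrite rF (cardsD1 x F) xF; clear; lia.
- constructor 3; apply/setP => x; rewrite inE; apply/negPn/negP => xF.
  have := flF x xF; have := mrank_leq_mrk M (x |: F).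
  by rewrite rF; clear; lia.
- constructor 2; apply/setP => x; apply/idP/idP => [xF|xH]; apply/negPn/negP.
    move=> xH; have := @cardU1D (F :\ x) H x; rewrite setD1K // xH setD11 => /(_ isT) cF.
    by have := cyF x xF; rewrite rF rk cF; clear; lia.
  move=> xF; have := flF x xF; rewrite rF rk cardU1D // xH.
  by clear; lia.
Qed.

(** In a forbidden minor, [f1] and [g] force the rank of [C] at least 2 below [k], and the loop then
    forces it to be [r + #|C :\: H|]. Non-loops hence lie outside [H], so [f1] and [f2] together
    raise the rank by 2 and cannot be parallel. *)
Lemma shape_cuspidal M p q H : cusp_shape M p q H -> cuspidal M.
Proof.
move=> sh; split.
  move=> F G /(shape_cyclic_flat sh)[]-> /(shape_cyclic_flat sh)[]->;
  by rewrite ?sub0set ?subsetT; auto.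
case: sh => _ _ rk [C [f [fi dis rkC]]].
have fC z : f z \notin C by apply/negbT/(disjointFl dis)/imset_f; rewrite inE.
set k := mrk M in rk; set r := k - p in rk.
have r1 z : (mrank M (f z |: C) - mrank M C) = forbidden_rank [set z].
  by rewrite -rkC imset_set1.
have r2 z z' : (mrank M (f z |: (f z' |: C)) - mrank M C) = forbidden_rank [set z; z'].
  by rewrite -rkC imsetU1 imset_set1 setUA.
have m1 z : mrank M (f z |: C) =
    minn #|C|.+1 (minn k (r + ((f z \notin H) + #|C :\: H|))).
  by rewrite rk cardU1D // cardsU1 fC.
have m2 z z' : z != z' -> mrank M (f z |: (f z' |: C)) =
    minn #|C|.+2 (minn k (r + ((f z \notin H) + ((f z' \notin H) + #|C :\: H|)))).
  move=> nz; have nzC : f z \notin f z' |: C by rewrite !inE (inj_eq fi) (negPf nz) fC.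
  by rewrite rk cardU1D // cardU1D // cardsU1 nzC cardsU1 fC.
pose e : 'I_1 + 'I_2 + 'I_1 := inl (inl ord0).
pose f1 : 'I_1 + 'I_2 + 'I_1 := inl (inr ord0).
pose f2 : 'I_1 + 'I_2 + 'I_1 := inl (inr (lift ord0 ord0)).
pose g : 'I_1 + 'I_2 + 'I_1 := inr ord0.
have mC := rk C; set m := mrank M C in mC r1 r2.
have k2 : m.+2 <= k.
  by have := r2 f1 g; rewrite m2 // forbidden_rankE !inE /=; clear; lia.
have mD : m = r + #|C :\: H|.
  have := r1 e; rewrite m1 forbidden_rankE !inE /=.
  by move: mC k2; case: (_ \in H); clear; lia.
have outH z : forbidden_rank [set z] = 1 -> f z \notin H.
  by move=> fz; have := r1 z; rewrite fz m1; move: mD; case: (_ \in H); clear; lia.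
have := r2 f1 f2; rewrite m2 // !outH; try by rewrite forbidden_rankE !inE.
rewrite forbidden_rankE !inE /=.
by have := mrank_leq_card M C; move: mD k2; rewrite -/m; clear; lia.
Qed.

(** [H] and [K] have equal size, and a permutation carrying one to the other preserves the rank
    formula. *)
Lemma shape_miso M N p q H K : mrk M = mrk N ->
  cusp_shape M p q H -> cusp_shape N p q K -> miso M N.
Proof.
move=> eMN [pM cH rkM] [pN cK rkN].
have [s sHK] : exists s : {perm T}, s @: H = K by apply: perm_imset_card; rewrite cH cK eMN.
exists s.
have si := @perm_inj _ s.
have rks A : mrank N (s @: A) = mrank M A.
  have imD : s @: A :\: s @: H = s @: (A :\: H).
    by apply/setP => x; rewrite -[x](permKV s) in_setD !mem_imset ?in_setD.
  by rewrite rkN rkM -sHK imD !card_imset // eMN.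
have memP A : (s @: A \in bases N) = (A \in bases M).
  by apply/mem_basesP/mem_basesP; rewrite rks card_imset ?eMN.
apply/setP => B; apply/idP/imsetP => [BN|[A AM ->]]; last by rewrite memP.
have eB : B = s @: (s @^-1: B).
  by apply/setP => x; rewrite -[x](permKV s) mem_imset ?inE //; apply: si.
by exists (s @^-1: B) => //; rewrite -memP -eB.
Qed.

Lemma mrank_miso M N : miso M N ->
  exists s : {perm T}, forall A, mrank N (s @: A) = mrank M A.
Proof.
move=> [s bN]; exists s => A; rewrite /mrank bN big_imset /=; last first.
  by move=> B C _ _; apply: imset_inj; apply: perm_inj.
apply: eq_bigr => B _; rewrite -imsetI ?card_imset //; last by move=> ? ? _ _; apply: perm_inj.
exact: perm_inj.
Qed.

Lemma shape_exists k p q : k <= #|T| -> p <= k -> q <= #|T| - k ->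
  exists M H, mrk M = k /\ cusp_shape M p q H.
Proof.
move=> kn pk qn.
have [H _ cH] : exists2 H : {set T}, H \subset [set: T] & #|H| = k - p + q.
  by apply: subset_of_card; rewrite cardsT; lia.
pose bs := [set B : {set T} | (#|B| == k) && (#|B :&: H| <= k - p)].
have bs0 : bs != set0.
  have [|B1 sB1 cB1] := @subset_of_card H (k - p); first by lia.
  have [|B2 sB2 cB2] := @subset_of_card (~: H) p.
    by have := cardsC H; lia.
  have d2 : B2 :&: H = set0.
    apply/setP => x; rewrite !inE; apply/negP => /andP[/(subsetP sB2)].
    by rewrite inE => /negP.
  apply/set0Pn; exists (B1 :|: B2); rewrite inE.
  have -> : (B1 :|: B2) :&: H = B1 by rewrite setIUl d2 setU0; apply/setIidPl.
  rewrite cB1 leqnn andbT cardsU cB1 cB2.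
  have -> : B1 :&: B2 = set0.
    by apply/eqP; rewrite -subset0 -d2 setIC setIS.
  by rewrite cards0; lia.
have bsx : basis_exchange bs.
  move=> B1 B2; rewrite !inE => /andP[/eqP c1 h1] /andP[/eqP c2 h2] x.
  rewrite inE => /andP[x2 x1].
  (* If removing [x] leaves room in [H], any [y] will do. Otherwise [y] must avoid [H]: [B2] has at
     least [p] elements outside [H], and [B1] without [x] only [p - 1]. *)
  have [y] : exists y, (y \in B2 :\: B1) /\
     #|B1 :&: H| + (y \in H) <= k - p + (x \in H).
    case: (boolP ((x \in H) || (#|B1 :&: H| < k - p))) => [cs|].
      have /subsetPn[y y2 y1] : ~~ (B2 \subset B1).
        apply/negP => s21; have /eqP e21 : B2 == B1 by rewrite eqEcard s21 c1 c2 leqnn.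
        by rewrite e21 x1 in x2.
      exists y; rewrite inE y1 y2; split=> //.
      by case/orP: cs h1 => [->|]; case: (y \in H); clear; lia.
    rewrite negb_or => /andP[xH full].
    have /subsetPn[y] : ~~ (B2 :\: H \subset (B1 :\: H) :\ x).
      apply/negP => /subset_leq_card.
      have := cardsD1 x (B1 :\: H); rewrite inE x1 xH /=.
      have := cardsID H B1; have := cardsID H B2.
      by move: h1 h2 full c1 c2; clear; lia.
    rewrite !inE negb_and negbK => /andP[yH y2].
    rewrite yH /= => /orP[/eqP yx|y1]; first by rewrite -yx y2 in x2.
    by exists y; rewrite !inE y1 y2 (negPf yH) addn0; split=> //; clear -h1; lia.
  rewrite inE => -[/andP[y1 y2] cnt]; exists y; rewrite !inE ?y1 //.
  have := card_swapI H x1 y1; rewrite card_swap // c1 eqxx /=.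
  by move: cnt; clear; lia.
pose M := Matroid bs0 bsx.
have rkM A : mrank M A = minn #|A| (minn k (k - p + #|A :\: H|)).
  have [B BM rA] := mrank_basis M A.
  move: (BM); rewrite inE => /andP[/eqP cB hB].
  apply/eqP; rewrite eqn_leq; apply/andP; split.
    have := subset_leq_card (subsetIl A B); have := subset_leq_card (subsetIr A B).
    rewrite rA cB.
    have /subset_leq_card : A :&: B \subset (B :&: H) :|: (A :\: H).
      by apply/subsetP => x; rewrite !inE => /andP[-> ->]; case: (x \in H).
    by rewrite cardsU; clear -hB; lia.
  rewrite leqNgt rA; apply/negP => lt.
  have ltA : #|A :&: B| < #|A| by move: lt; clear; lia.
  have ltB : #|A :&: B| < #|B| by move: lt; rewrite cB; clear; lia.
  (* As [B] attains the rank of [A], an improving swap must leave [bs], which only the bound on [H]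
     can cause. Hence [A :\: H] lies in [B] and [B :&: H] in [A], and [A :&: B] is already large
     enough. *)
  have noswap x y : x \in A -> x \notin B -> y \in B -> y \notin A ->
      [/\ #|B :&: H| = k - p, x \in H & y \notin H].
    move=> xA xB yB yA.
    have := card_swapI H yB xB; have := card_swapI A yB xB.
    set B' := B :\ y :|: [set x]; have cB' : #|B'| == k by rewrite card_swap // cB.
    rewrite xA (negPf yA) => swA swH.
    case: (boolP (B' \in bs)) => B'M.
      have := leq_mrank A (B'M : B' \in bases M).
      by rewrite rA ![A :&: _]setIC; move: swA; clear; lia.
    move: B'M; rewrite inE cB' /= -ltnNge => hB'; move: swH hB hB'.
    by case: (x \in H); case: (y \in H) => e le1 lt2; split=> //; clear -e le1 lt2; lia.
  have [x xA xB] : exists2 x, x \in A & x \notin B.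
    apply/subsetPn; apply/negP => /setIidPl e; by rewrite e ltnn in ltA.
  have [y yB yA] : exists2 y, y \in B & y \notin A.
    apply/subsetPn; apply/negP => /setIidPr e; by rewrite e ltnn in ltB.
  have [full _ _] := noswap x y xA xB yB yA.
  have sAH : A :\: H \subset A :&: B.
    apply/subsetP => z; rewrite !inE => /andP[zH zA]; rewrite zA /=.
    by apply/negPn/negP => zB; have [_] := noswap z y zA zB yB yA; rewrite (negPf zH).
  have sBH : B :&: H \subset A :&: B.
    apply/subsetP => z; rewrite !inE => /andP[zB zH]; rewrite zB andbT.
    by apply/negPn/negP => zA; have [_ _] := noswap x z xA xB zB zA; rewrite zH.
  have /subset_leq_card : (B :&: H) :|: (A :\: H) \subset A :&: B by rewrite subUset sAH sBH.
  have d0 : (B :&: H) :&: (A :\: H) = set0.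
    by apply/setP => z; rewrite !inE; case: (z \in H); rewrite ?andbF.
  by rewrite cardsU d0 cards0 full; move: lt; clear; lia.
have mk : mrk M = k.
  have [B BM] := set0Pn _ bs0; rewrite (@mrk_bases _ M B BM).
  by move: BM; rewrite inE => /andP[/eqP].
by exists M, H; split=> //; split; rewrite ?mk.
Qed.

End Shape.

Local Open Scope ring_scope.

(** * Tutte polynomials modulo the uniform one *)

Section Tutte.
Variable T : finType.
Implicit Types (M N : matroid T) (A H : {set T}).

Definition corank M A : nat := (mrk M - mrank M A)%N.
Definition nullity M A : nat := (#|A| - mrank M A)%N.

Lemma nullity_leq M A : (nullity M A <= #|T| - mrk M)%N.
Proof.
have := mrank_leqD M setT A; have := mrank_leq_card M A.
by rewrite -/(mrk M) setTD -(cardsC A) /nullity; clear; lia.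
Qed.

Lemma shape_corank_nullity M p q H : cusp_shape M p q H ->
  corank M H = p /\ nullity M H = q.
Proof.
move=> [pk cH rk]; rewrite /corank /nullity rk setDv cards0 cH.
by move: pk; clear; lia.
Qed.

(** Positive corank and nullity select the third term of the minimum, so the corank is
    [p - #|A :\: H|] and the nullity is [q - #|H :\: A|]. *)
Lemma shape_leq M p q H A : cusp_shape M p q H ->
  (0 < corank M A)%N -> (0 < nullity M A)%N ->
  [/\ (corank M A <= p)%N, (nullity M A <= q)%N &
      corank M A = p -> nullity M A = q -> A = H].
Proof.
move=> [pk cH rk]; rewrite /corank /nullity !subn_gt0 => c0 n0.
have rA : mrank M A = (mrk M - p + #|A :\: H|)%N.
  by move: c0 n0; rewrite rk; clear; lia.
have cA := cardsID H A.
have cAH := subset_leq_card (subsetIr A H).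
split; first by move: c0; rewrite rA; clear -pk; lia.
  by move: n0; rewrite rA; clear -cA cAH cH pk; lia.
rewrite rA => e1 e2.
have d0 : #|A :\: H| = 0%N by clear -e1 pk c0 rA; lia.
apply/eqP; rewrite eqEcard -setD_eq0 -cards_eq0 d0 eqxx /=.
by clear -e2 d0 cH cA cAH n0 rA; lia.
Qed.

Local Notation PP := {poly {poly int}}.
Local Notation u := ('X - 1 : PP).
Local Notation v := (('X - 1)%:P : PP).

(** For [k <= #|T|], the Tutte polynomial of the uniform matroid of rank [k]: the truncated
    exponents are the corank and nullity there. *)
Definition uniform_tutte k : PP :=
  \sum_(A : {set T}) u ^+ (k - #|A|) * v ^+ (#|A| - k).

(** The term of a set of corank [i] and nullity [j], minus the term of a set of the same size in the
    uniform matroid. *)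
Definition lower_term (i j : nat) : PP :=
  u ^+ i * v ^+ j - u ^+ (i - j) * v ^+ (j - i).

Lemma lower_term_eq0 i j : ~~ ((0 < i) && (0 < j))%N -> lower_term i j = 0.
Proof.
rewrite /lower_term; case: i => [|i] /=; first by rewrite sub0n subn0 subrr.
by case: j => // _; rewrite sub0n subn0 subrr.
Qed.

(* Since corank - nullity = k - |A|, each term of the rank generating function
   is determined by |A| up to a multiple of (x - 1)(y - 1). *)
Lemma tutteE M : tutte M = uniform_tutte (mrk M) +
  \sum_(A : {set T}) lower_term (corank M A) (nullity M A).
Proof.
rewrite /uniform_tutte -big_split; apply: eq_bigr => A _ /=.
rewrite /lower_term /corank /nullity.
have := mrank_leq_card M A; have := mrank_leq_mrk M A => le1 le2.
have -> : (mrk M - #|A| = mrk M - mrank M A - (#|A| - mrank M A))%N by lia.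
have -> : (#|A| - mrk M = #|A| - mrank M A - (mrk M - mrank M A))%N by lia.
by rewrite addrC subrK.
Qed.

Lemma tutte_miso M N : miso M N -> tutte M = tutte N.
Proof.
move=> /mrank_miso[s rs]; rewrite /tutte.
rewrite [RHS](reindex_inj (imset_inj (@perm_inj _ s))); apply: eq_bigr => A _.
have sT : s @: setT = setT.
  by apply/eqP; rewrite eqEcard subsetT (card_imset _ (@perm_inj _ s)) /=.
have -> : mrk N = mrk M by rewrite /mrk -rs sT.
by rewrite rs card_imset //; apply: perm_inj.
Qed.

End Tutte.

(** * Independence and spanning over the integers *)

Section Coefficients.
Local Notation PP := {poly {poly int}}.

(** The substitution of [x + 1] for [x] and [y + 1] for [y], after which coefficients count sets of
    given corank and nullity. *)
Definition tutte_shift : PP -> PP :=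
  comp_poly ('X + 1) \o map_poly (comp_poly ('X + 1)).

HB.instance Definition _ := GRing.RMorphism.on tutte_shift.

Lemma tutte_shift_monomial i j :
  tutte_shift (('X - 1) ^+ i * (('X - 1)%:P) ^+ j) = 'X^i * ('X^j)%:P.
Proof.
rewrite rmorphM !rmorphXn /=.
have -> : tutte_shift ('X - 1) = 'X.
  by rewrite /tutte_shift /= rmorphB rmorph1 /= map_polyX rmorphB rmorph1 /= comp_polyX addrK.
have -> // : tutte_shift (('X - 1)%:P) = 'X%:P.
by rewrite /tutte_shift /= map_polyC /= comp_polyC rmorphB rmorph1 /= comp_polyX addrK.
Qed.

Lemma coef_tutte_shift (T : finType) (M : matroid T) i j :
  (tutte_shift (tutte M))`_i`_j =
  #|[set A : {set T} | (corank M A == i) && (nullity M A == j)]|%:R.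
Proof.
rewrite /tutte rmorph_sum !coef_sum -sum1_card natr_sum [RHS]big_mkcond /=.
apply: eq_bigr => A _; rewrite tutte_shift_monomial coefMC coefXn inE.
rewrite -/(corank M A) -/(nullity M A) (eq_sym i) (eq_sym _ i).
case: (i == corank M A); last by rewrite mul0r coef0.
by rewrite mul1r coefXn eq_sym; case: (_ == j).
Qed.

(** Take [i] with [d i] nonzero and [p i + q i] maximal, and read the coefficient at [(p i, q i)].
    By [shape_leq] and maximality no other matroid with nonzero coefficient contributes, while [H i]
    is counted for [N i]. *)
Lemma tutte_free (T : finType) s (N : 'I_s -> matroid T) (p q : 'I_s -> nat)
    (H : 'I_s -> {set T}) (d : 'I_s -> int) :
  (forall i, cusp_shape (N i) (p i) (q i) (H i)) ->
  (forall i, (0 < p i)%N = (0 < q i)%N) ->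
  (forall i j, p i = p j -> q i = q j -> i = j) ->
  \sum_(i < s) (d i)%:~R * tutte (N i) = 0 -> d =1 fun=> 0.
Proof.
move=> sh pq inj sum0 i0; apply/eqP/negPn/negP => d0.
case: (@arg_maxnP _ i0 (fun i => d i != 0) (fun i => p i + q i)%N d0) => i di maxi.
pose a j := #|[set A | (corank (N j) A == p i) && (nullity (N j) A == q i)]|.
have /eqP := congr1 (fun P => (tutte_shift P)`_(p i)`_(q i)) sum0.
rewrite rmorph0 !coef0 rmorph_sum !coef_sum.
under eq_bigr => j _.
  rewrite rmorphM rmorph_int mulrzl -!/(coefp _ _) !raddfMz /= coef_tutte_shift -/(a j).
  over.
rewrite (bigD1 i) //= big1 => [|j nji]; last first.
  case: (posnP (a j)) => [->|]; first by rewrite mul0rz.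
  case/card_gt0P => A; rewrite inE => /andP[/eqP cA /eqP nA].
  case: (eqVneq (d j) 0) => [->//|/maxi le]; case/eqP: nji.
  (* Outside the range of [shape_leq], [p i] and [q i] both vanish, and maximality forces [p j] and
     [q j] to vanish too. *)
  case: (posnP (p i)) => [p0|p0].
    have q0 : q i = 0%N by move: (pq i); rewrite p0; case: (q i).
    by apply: inj; move: le; rewrite p0 q0; clear; lia.
  have := @shape_leq _ _ _ _ _ A (sh j); rewrite cA nA -(pq i) => /(_ p0 p0)[le1 le2 _].
  by apply: inj; move: le le1 le2; clear; lia.
rewrite addr0 -mulrzl intz mulf_eq0 (negPf di) /= Num.Theory.pnatr_eq0 cards_eq0.
case/set0Pn; exists (H i); have [cH nH] := shape_corank_nullity (sh i).
by rewrite inE cH nH !eqxx.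
Qed.

Definition int_span s (t : 'I_s -> PP) (P : PP) : Prop :=
  exists c : 'I_s -> int, P = \sum_(i < s) (c i)%:~R * t i.

Section Span.
Variables (s : nat) (t : 'I_s -> PP).

Lemma int_span_gen i : int_span t (t i).
Proof.
exists (fun j => (j == i)%:R); rewrite (bigD1 i) //= eqxx mul1r big1 ?addr0 //.
by move=> j /negPf->; rewrite mul0r.
Qed.

Lemma int_span0 : int_span t 0.
Proof. by exists (fun=> 0); rewrite big1 // => i _; rewrite mul0r. Qed.

Lemma int_spanD P Q : int_span t P -> int_span t Q -> int_span t (P + Q).
Proof.
move=> [c ->] [d ->]; exists (fun i => c i + d i).
by rewrite -big_split; apply: eq_bigr => i _; rewrite intrD mulrDl.
Qed.

Lemma int_spanB P Q : int_span t P -> int_span t Q -> int_span t (P - Q).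
Proof.
move=> [c ->] [d ->]; exists (fun i => c i - d i).
by rewrite -sumrB; apply: eq_bigr => i _; rewrite intrB mulrBl.
Qed.

Lemma int_span_sum (I : finType) (R : pred I) (F : I -> PP) :
  (forall i, R i -> int_span t (F i)) -> int_span t (\sum_(i | R i) F i).
Proof. by move=> sF; apply: big_ind => //; [apply: int_span0|apply: int_spanD]. Qed.

End Span.

Lemma tutte_span (T : finType) k s (t : 'I_s -> PP) : (k <= #|T|)%N ->
  (forall M : matroid T, cuspidal M -> mrk M = k -> int_span t (tutte M)) ->
  forall M : matroid T, mrk M = k -> int_span t (tutte M).
Proof.
move=> kn cspan.
have uspan : int_span t (uniform_tutte T k).
  (* The shape with [p = q = 0] is uniform, so all its lower terms vanish. *)
  have [M [H [Mk sh]]] := shape_exists kn (leq0n k) (leq0n _).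
  have <- : tutte M = uniform_tutte T k; last by apply: cspan (shape_cuspidal sh) Mk.
  rewrite tutteE Mk big1 ?addr0 // => A _; apply: lower_term_eq0.
  apply/negP => /andP[c0 n0]; have [] := shape_leq sh c0 n0.
  by move: c0; clear; lia.
(* Induction on [p + q]: the matroid of shape [(p, q)] contributes this lower term once, at [A = H],
   and otherwise only terms of smaller index sum. The bounds on [p] and [q] make that matroid
   exist. *)
have lspan m : forall p q, (p + q <= m)%N -> (p <= k)%N -> (q <= #|T| - k)%N ->
    int_span t (lower_term p q).
  elim: m => [|m IHm] p q pqm pk qn.
    rewrite lower_term_eq0; first exact: int_span0.
    by clear -pqm; lia.
  case: (boolP ((0 < p) && (0 < q))%N) => [|/lower_term_eq0->]; last exact: int_span0.
  case/andP=> p0 q0; have [M [H [Mk sh]]] := shape_exists kn pk qn.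
  have := tutteE M; rewrite Mk (bigD1 H) //=.
  have [-> ->] := shape_corank_nullity sh.
  set S := \sum_(_ | _) _ => eM.
  have -> : lower_term p q = tutte M - uniform_tutte T k - S by rewrite eM; ring.
  apply: int_spanB; first by apply: int_spanB => //; apply: cspan (shape_cuspidal sh) Mk.
  apply: int_span_sum => A nAH.
  case: (boolP ((0 < corank M A) && (0 < nullity M A))%N) => [|/lower_term_eq0->].
  2: exact: int_span0.
  case/andP=> c0 n0; have [lep leq AH] := shape_leq sh c0 n0.
  apply: IHm; [|exact: leq_trans pk|exact: leq_trans qn].
  have : corank M A != p \/ nullity M A != q.
    case: (eqVneq (corank M A) p) => [ep|]; last by left.
    by right; apply: contra nAH => /eqP eq; rewrite (AH ep eq).
  by clear -lep leq pqm; lia.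
move=> M Mk; rewrite tutteE Mk; apply: int_spanD => //; apply: int_span_sum => A _.
by apply: (lspan _ _ _ (leqnn _)); rewrite -Mk ?nullity_leq ?leq_subr.
Qed.

End Coefficients.

Theorem theoremC (n k s : nat) (N : 'I_s -> matroid 'I_n) :
  (k <= n)%N ->
  (forall i, cuspidal (N i) /\ mrk (N i) = k) ->
  (forall i j, miso (N i) (N j) -> i = j) ->
  (forall M : matroid 'I_n, cuspidal M -> mrk M = k -> exists i, miso M (N i)) ->
  forall M : matroid 'I_n, mrk M = k ->
    exists c : 'I_s -> int,
      tutte M = \sum_(i < s) (c i)%:~R * tutte (N i) /\
      (forall c' : 'I_s -> int,
         tutte M = \sum_(i < s) (c' i)%:~R * tutte (N i) -> c' =1 c).
Proof.
move=> kn cuspN isoN repN M Mk.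
have [c eM] : int_span (fun i => tutte (N i)) (tutte M).
  apply: (@tutte_span _ k) => //; first by rewrite card_ord.
  by move=> M' cM /(repN _ cM)[i /tutte_miso->]; apply: (int_span_gen (fun i => tutte (N i))).
exists c; split=> // c' eM'.
have /fin_all_exists[w shN] : forall i, exists w : nat * nat * {set 'I_n},
    cusp_shape (N i) w.1.1 w.1.2 w.2 /\ (0 < w.1.1)%N = (0 < w.1.2)%N.
  by move=> i; have [p [q [H sh]]] := cuspidal_shape (cuspN i).1; exists (p, q, H).
(* Two expansions of [tutte M] differ by a relation among the representatives; equal pairs [(p, q)]
   would make two of them isomorphic. *)
have : (fun i => c' i - c i) =1 fun=> 0.
  apply: (@tutte_free _ s N (fun i => (w i).1.1) (fun i => (w i).1.2) (fun i => (w i).2)).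
  - by move=> i; case: (shN i).
  - by move=> i; case: (shN i).
  - move=> i j ep eq; apply: isoN; have [shi _] := shN i; have [shj _] := shN j.
    rewrite -ep -eq in shj; apply: shape_miso shi shj.
    by rewrite (cuspN i).2 (cuspN j).2.
  under eq_bigr => i _ do rewrite intrB mulrBl.
  by rewrite sumrB -eM -eM' subrr.
by move=> d0 i; apply/eqP; rewrite -subr_eq0 d0.
Qed.
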